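(* Let $L$, $D$, $A_j$, $b_j$, $p_j$ and $E(L)$ be as in the context, and let $f\in H\cap C^2(I)$ with $\|f''\|_\infty=\sup_{t\in I}|f''(t)|<\infty$. Then $$|Lf(x)-Df(x)|\le \frac12\,\|f''\|_\infty\,E(L)(x)\qquad\text{for all }x\in I .$$
   Context: Let $I\subset\mathbb{R}$ be an interval, $e_i(t)=t^i$, and let $H$ be a linear subspace of $C(I)$ containing $e_0,e_1,e_2$. Let $p_j\in C(I)$ ($j\ge 0$) with $p_j\ge 0$ and $\sum_{j=0}^\infty p_j=e_0$ pointwise on $I$. Let $A_j:H\to\mathbb{R}$ ($j\ge 0$) be positive linear functionals (that is, $A_j(f)\ge 0$ whenever $f\in H$, $f\ge 0$ on $I$) with $A_j(e_0)=1$. Assume that $Lf:=\sum_{j=0}^\infty A_j(f)\,p_j$ defines a positive linear operator $L:H\to C(I)$ (the series converging pointwise on $I$ for every $f\in H$). Put $b_j:=A_j(e_1)$ and $\operatorname{Var}A_j:=A_j(e_2)-b_j^2$. It is assumed that $b_j\in I$ for all $j$ and that the discrete operator associated with $L$, $Df:=\sum_{j=0}^\infty f(b_j)\,p_j$, is well defined as an operator $D:H\to C(I)$. Finally $E(L)(x):=\sum_{j=0}^\infty(\operatorname{Var}A_j)\,p_j(x)$ for $x\in I$. *)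

(* Defs.v *)
From HB Require Import structures.
From mathcomp Require Import all_boot all_order all_algebra.
From mathcomp Require Import all_classical all_reals all_analysis.

Set Implicit Arguments.
Unset Strict Implicit.
Unset Printing Implicit Defensive.

Import Order.TTheory GRing.Theory Num.Theory.
Import numFieldNormedType.Exports.

Local Open Scope classical_set_scope.
Local Open Scope ring_scope.

(* A real function on I is represented by a total function R -> R whose values
   outside I are irrelevant.  C(I) is thus the set of all f : R -> R that are
   continuous on I for the subspace topology, two functions being identified
   when they agree on I. *)
Section Operators.
Context {R : realType}.
Implicit Types (I : set R) (H : set (R -> R)) (f g : R -> R).

Definition monom (i : nat) : R -> R := fun t => t ^+ i.

Definition contI I f : Prop := {within I, continuous f}.

(* The second clause says that membership in H depends only on the restriction
   to I. *)
Definition subspaceC I H : Prop :=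
  [/\ forall f, H f -> contI I f,
      forall f g, H f -> (forall t, I t -> f t = g t) -> H g,
      H (fun=> 0) &
      forall (a : R) f g, H f -> H g -> H (fun t => a * f t + g t)].

Definition linear_functional H (A : (R -> R) -> R) : Prop :=
  forall (a : R) f g, H f -> H g -> A (fun t => a * f t + g t) = a * A f + A g.

Definition positive_functional I H (A : (R -> R) -> R) : Prop :=
  forall f, H f -> (forall t, I t -> 0 <= f t) -> 0 <= A f.

Definition maps_to_C I H (T : (R -> R) -> R -> R) : Prop :=
  forall f, H f -> contI I (T f).

Definition linear_operator I H (T : (R -> R) -> R -> R) : Prop :=
  forall (a : R) f g, H f -> H g ->
    forall x, I x -> T (fun t => a * f t + g t) x = a * T f x + T g x.

Definition positive_operator I H (T : (R -> R) -> R -> R) : Prop :=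
  forall f, H f -> (forall t, I t -> 0 <= f t) -> forall x, I x -> 0 <= T f x.

(* Sequence of partial sums of c_0 p_0(x) + c_1 p_1(x) + ... *)
Definition psums (p : nat -> R -> R) (c : nat -> R) (x : R) : nat -> R :=
  series (fun j => c j * p j x).

(* b_j is the barycenter A_j(e_1). *)
Definition bary (A : nat -> (R -> R) -> R) (j : nat) : R := A j (monom 1).

Definition VarA (A : nat -> (R -> R) -> R) (j : nat) : R :=
  A j (monom 2) - bary A j ^+ 2.

(* [limn] has a junk value for divergent sequences; convergence of the series
   defining L and D is a separate hypothesis, and it implies that of the
   series defining E(L) as soon as monom 2 is in H. *)
Definition opL p (A : nat -> (R -> R) -> R) f (x : R) : R :=
  limn (psums p (fun j => A j f) x).

Definition opD p (A : nat -> (R -> R) -> R) f (x : R) : R :=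
  limn (psums p (fun j => f (bary A j)) x).

Definition opE p (A : nat -> (R -> R) -> R) (x : R) : R :=
  limn (psums p (VarA A) x).

(* Derivatives relative to I: the limit of the difference quotient is taken
   along points of I, so it is the usual derivative at interior points and the
   one-sided derivative at an endpoint belonging to I. *)
Definition derivableI I f (x : R) : Prop :=
  cvg ((f y - f x) / (y - x) @[y --> within I x^']).

Definition derivI I f (x : R) : R :=
  lim ((f y - f x) / (y - x) @[y --> within I x^']).

Definition C2 I f : Prop :=
  [/\ forall x, I x -> derivableI I f x,
      forall x, I x -> derivableI I (derivI I f) x &
      contI I (derivI I (derivI I f))].

Definition absval_set I g : set R := [set `|g t| | t in I].

Definition supnorm I g : R := sup (absval_set I g).

End Operators.

(* Main.v *)
Require Import Defs.
From mathcomp Require Import all_boot all_order all_algebra.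
From mathcomp Require Import all_classical all_reals all_analysis.
From mathcomp Require Import ring lra.
Import Order.TTheory GRing.Theory Num.Theory.
Import numFieldNormedType.Exports.
Local Open Scope classical_set_scope.
Local Open Scope ring_scope.

(* With b = b_j, Taylor's formula bounds |f(t) - f(b) - f'(b)(t - b)| by
   M/2 (t - b)^2 on I, where M = ||f''||.  Applying the positive functional A_j,
   which kills e_1 - b e_0 and sends (e_1 - b e_0)^2 to Var A_j, gives
   |A_j(f) - f(b_j)| <= M/2 Var A_j, and it remains to sum against p_j >= 0. *)

Section RelativeDerivative.
Local Set Implicit Arguments.
Local Unset Strict Implicit.
Context {R : realType}.
Implicit Types (I : set R) (F G : R -> R).

(* If I = {x} the filter is trivial and every l is a derivative of F at x; the
   lemmas below therefore never use uniqueness of the derivative on I. *)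
Definition has_derivI I F (x l : R) : Prop :=
  (F y - F x) / (y - x) @[y --> within I x^'] --> l.

Lemma has_derivI_eps I F x l : has_derivI I F x l -> forall e, 0 < e ->
  exists2 d, 0 < d & forall y, I y -> y != x -> `|y - x| < d ->
    `|l - (F y - F x) / (y - x)| < e.
Proof.
move=> /cvgrPdist_lt Fl e e0; have /nbhs_ballP[d /= d0 dF] := Fl e e0.
exists d => // y Iy yx yd; apply: dF => //.
by rewrite -ball_normE /ball_ /= distrC.
Qed.

(** Tolerance 1 in the limit bounds the quotient by [|l| + 1] near [x], a local Lipschitz bound; the
    radius [e / (|l| + 1)] turns it into [e]. The point [y = x], excluded from the quotient, is
    treated apart. *)
Lemma has_derivI_continuous I F x l :
  has_derivI I F x l -> F @ within I (nbhs x) --> F x.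
Proof.
move=> /has_derivI_eps Fl; apply/cvgrPdist_lt => e e0.
have [d d0 dF] := Fl 1 ltr01.
have l1 : 0 < `|l| + 1 by rewrite ltr_wpDl.
apply/nbhs_ballP; exists (Num.min d (e / (`|l| + 1))) => /=.
  by rewrite lt_min d0 divr_gt0.
move=> y; rewrite -ball_normE /ball_ /= lt_min => /andP[yd ye] Iy.
have [->|yx] := eqVneq y x; first by rewrite subrr normr0.
have yx0 : y - x != 0 by rewrite subr_eq0.
have {}dF : `|(F y - F x) / (y - x)| < `|l| + 1.
  have := dF y Iy yx; rewrite distrC => /(_ yd) {}dF.
  have := ler_distD l ((F y - F x) / (y - x)) 0.
  by rewrite !subr0 [X in _ <= X + _]distrC; lra.
rewrite distrC -[F y - F x](divfK yx0) normrM.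
apply: (@le_lt_trans _ _ ((`|l| + 1) * `|y - x|)).
  by rewrite ler_wpM2r// ltW.
by rewrite mulrC -ltr_pdivlMr// distrC.
Qed.

(** Once [|h|] is below the radius of a ball around [x] inside [I], [x + h] stays in [I] and the
    relative quotient is the ordinary one. *)
Lemma has_derivI_is_derive I F x l :
  nbhs x I -> has_derivI I F x l -> is_derive x 1 F l.
Proof.
move=> /nbhs_ballP[r /= r0 rI] /has_derivI_eps Fl.
suff Fxl : h^-1 *: ((F \o shift x) (h *: 1) - F x) @[h --> 0^'] --> l.
  apply: DeriveDef; first by apply/cvg_ex; exists l.
  exact: cvg_lim.
apply/cvgrPdist_lt => e e0; have [d d0 dF] := Fl e e0.
apply/nbhs_ballP; exists (Num.min d r) => /=; first by rewrite lt_min d0.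
move=> h; rewrite -ball_normE /ball_ /= sub0r normrN lt_min => /andP[hd hr] h0.
have hE : h *: 1 + x - x = h by rewrite addrK /GRing.scale /= mulr1.
have := dF (h *: 1 + x); rewrite hE mulrC; apply => //.
  by apply: rI; rewrite -ball_normE /ball_ /= distrC hE.
by rewrite -subr_eq0 hE.
Qed.

Lemma is_interval_nbhs I a b x : is_interval I -> I a -> I b ->
  x \in `]a, b[ -> nbhs x I.
Proof.
move=> itvI Ia Ib xab; have := near_in_itvoo xab; apply: filterS => y.
by rewrite in_itv /= => /andP[ay yb]; apply: (itvI a b) => //; rewrite !ltW.
Qed.

(** Points of []a, b[] are interior to [I], so relative derivatives are ordinary there; at [a] and
    [b] the classical theorem asks only for continuity within [[a, b]]. *)
Lemma MVT_lt_rel I F G a b : is_interval I ->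
  (forall x, I x -> has_derivI I F x (G x)) -> I a -> I b -> a < b ->
  exists2 c, c \in `]a, b[ & F b - F a = G c * (b - a).
Proof.
move=> itvI FG Ia Ib ab.
have sub x : x \in `[a, b] -> I x.
  by rewrite in_itv /= => xab; exact: (itvI a b).
apply: MVT => //.
- move=> x xab; apply: (has_derivI_is_derive (I := I)).
    exact: (is_interval_nbhs (a := a) (b := b)).
  by apply: FG; apply: sub; apply: subset_itv_oo_cc.
- apply/subspace_continuousP => x xab.
  have /FG/has_derivI_continuous Fx := sub x xab.
  by apply: cvg_trans Fx; apply: cvg_app; apply: within_subset => y; apply: sub.
Qed.

(** Form free of any order between [a] and [b]: the sign condition puts [c] on the same side of [a]
    as [b], which spares the Taylor estimate a case distinction. *)
Lemma MVT_rel I F G a b : is_interval I ->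
  (forall x, I x -> has_derivI I F x (G x)) -> I a -> I b ->
  exists c, [/\ I c, 0 <= (c - a) * (b - a), `|c - a| <= `|b - a| &
    F b - F a = G c * (b - a)].
Proof.
move=> itvI FG Ia Ib.
have [ab|ba|->] := ltgtP a b; last first.
- by exists b; split=> //; rewrite !subrr mulr0.
- have [c] := MVT_lt_rel itvI FG Ib Ia ba.
  rewrite in_itv /= => /andP[bc ca] Fab; exists c; split.
  + by apply: (itvI b a) => //; rewrite !ltW.
  + by rewrite -mulrNN !opprB mulr_ge0// subr_ge0 ltW.
  + by rewrite distrC [leRHS]distrC !ger0_norm ?subr_ge0 ?ltW//; lra.
  + by rewrite -opprB Fab -mulrN opprB.
- have [c] := MVT_lt_rel itvI FG Ia Ib ab.
  rewrite in_itv /= => /andP[ac cb] Fab; exists c; split => //.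
  + by apply: (itvI a b) => //; rewrite !ltW.
  + by rewrite mulr_ge0// subr_ge0 ltW.
  + by rewrite !ger0_norm ?subr_ge0 ?ltW//; lra.
Qed.

Lemma taylor1_rel_le I F G K M b t : is_interval I ->
  (forall x, I x -> has_derivI I F x (G x)) ->
  (forall x, I x -> has_derivI I G x (K x)) ->
  (forall x, I x -> `|K x| <= M) -> I b -> I t ->
  F t - F b - G b * (t - b) <= M / 2 * (t - b) ^+ 2.
Proof.
move=> itvI FG GK KM Ib It.
(* phi'(c) has the sign of c - b, hence phi >= phi b = 0 on both sides of b *)
pose phi s := M / 2 * (s - b) ^+ 2 - (F s - F b - G b * (s - b)).
pose dphi s := M * (s - b) - (G s - G b).
have phiD x : I x -> has_derivI I phi x (dphi x).
  move=> Ix.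
  have idx : (fun y : R => y) @ within I x^' --> x.
    apply: cvg_within_filter; apply: cvg_within_filter; exact: cvg_id.
  have cstW (c : R) : (fun=> c) @ within I x^' --> c by exact: cvg_cst.
  (* This is the difference quotient of [phi] after simplification: [(s - b) ^+ 2] contributes
     [(y - b) + (x - b)], and the affine term contributes [G b]. *)
  have quot : M / 2 * ((y - b) + (x - b)) - ((F y - F x) / (y - x) - G b)
      @[y --> within I x^'] --> M / 2 * ((x - b) + (x - b)) - (G x - G b).
    apply: cvgB; last by apply: cvgB; [exact: FG|exact: cstW].
    apply: cvgM; first exact: cstW.
    by apply: cvgD; [apply: cvgB => //; exact: cstW|exact: cstW].
  have -> : dphi x = M / 2 * ((x - b) + (x - b)) - (G x - G b).
    by rewrite /dphi; field.
  apply: cvg_trans quot; apply: near_eq_cvg.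
  apply/nbhs_ballP; exists 1 => //= y _ yx Iy.
  rewrite /phi; field.
  by rewrite subr_eq0.
have [c [Ic cb cbt phiE]] := MVT_rel itvI phiD Ib It.
have [d [Id _ _ GE]] := MVT_rel itvI GK Ib Ic.
(* By [GE], [dphi c = (M - K d) * (c - b)]; the first factor is nonnegative since [K d <= M], and
   [cb] gives the sign of [(c - b) * (t - b)]. *)
have dc : 0 <= dphi c * (t - b).
  rewrite /dphi GE -mulrBl -mulrA mulr_ge0// subr_ge0.
  by apply: le_trans (KM d Id); exact: ler_norm.
have phib : phi b = 0 by rewrite /phi; ring.
by move: dc; rewrite -phiE phib subr0 /phi subr_ge0.
Qed.

(** The lower bound is the one-sided estimate for [- F], [- G], [- K], which satisfy the same
    hypotheses with the same [M]. *)
Lemma taylor1_rel I F G K M b t : is_interval I ->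
  (forall x, I x -> has_derivI I F x (G x)) ->
  (forall x, I x -> has_derivI I G x (K x)) ->
  (forall x, I x -> `|K x| <= M) -> I b -> I t ->
  `|F t - F b - G b * (t - b)| <= M / 2 * (t - b) ^+ 2.
Proof.
move=> itvI FG GK KM Ib It; rewrite ler_norml; apply/andP; split; last first.
  by have := taylor1_rel_le itvI FG GK KM Ib It.
have derivN f g : (forall x, I x -> has_derivI I f x (g x)) ->
    forall x, I x -> has_derivI I (fun y => - f y) x (- g x).
  move=> fg x Ix; have fgN : - ((f y - f x) / (y - x))
      @[y --> within I x^'] --> - g x by apply: cvgN; exact: fg.
  apply: cvg_trans fgN; apply: near_eq_cvg.
  by apply/nbhs_ballP; exists 1 => //= y _ _ _; rewrite -opprD mulNr.
have NKM x : I x -> `|- K x| <= M by rewrite normrN; exact: KM.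
have := taylor1_rel_le itvI (derivN _ _ FG) (derivN _ _ GK) NKM Ib It.
lra.
Qed.

(** Any slope [m] will do: [A j] sends [m * (t - b)] to [m * (b - b) = 0]. *)
Lemma norm_functional_sub_bary_le I (H : set (R -> R))
    (A : nat -> (R -> R) -> R) (j : nat) (f : R -> R) (M m : R) :
  subspaceC I H -> H (monom 0) -> H (monom 1) -> H (monom 2) ->
  linear_functional H (A j) -> positive_functional I H (A j) ->
  A j (monom 0) = 1 -> H f ->
  (forall t, I t ->
    `|f t - f (bary A j) - m * (t - bary A j)|
      <= M / 2 * (t - bary A j) ^+ 2) ->
  `|A j f - f (bary A j)| <= M / 2 * VarA A j.
Proof.
move=> [_ _ H0 Hlin] He0 He1 He2 Alin Apos Ae0 Hf fM.
set b := bary A j in fM *.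
have A0 : A j (fun=> 0) = 0.
  have := Alin 1 _ _ H0 H0; under eq_fun do rewrite mulr0 addr0.
  by rewrite mul1r => /eqP; rewrite -subr_eq0 opprD addNKr oppr_eq0 => /eqP.
(* Positivity and linearity for combinations of [monom 2], [monom 1], [monom 0] and [f]. The
   trailing [+ 0] fits [k * f] to the shape [a * f + g] of the closure clause, and [A0] removes
   it. *)
have comb k2 k1 k0 k :
    (forall t, I t -> 0 <= k2 * t ^+ 2 + (k1 * t + (k0 + k * f t))) ->
    0 <= k2 * A j (monom 2) + (k1 * b + (k0 + k * A j f)).
  move=> q0.
  have Hk : H (fun t => k * f t + 0) by exact: Hlin.
  have Hk0 : H (fun t => k0 * monom 0 t + (k * f t + 0)) by exact: Hlin.
  have Hk1 : H (fun t => k1 * monom 1 t + (k0 * monom 0 t + (k * f t + 0))).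
    exact: Hlin.
  have Hk2 : H (fun t => k2 * monom 2 t +
      (k1 * monom 1 t + (k0 * monom 0 t + (k * f t + 0)))) by exact: Hlin.
  have := Apos _ Hk2; rewrite !Alin// A0 Ae0 mulr1 addr0 -/(bary A j) -/b.
  by apply=> t It; rewrite addr0; exact: q0.
(* The coefficients come from expanding [M / 2 * (t - b) ^+ 2 - (f t - f b - m * (t - b))] in powers
   of [t]; [lo] uses the opposite sign of the remainder. *)
have up : 0 <= M / 2 * A j (monom 2) + ((m - M * b) * b +
    (M / 2 * b ^+ 2 + f b - m * b + -1 * A j f)).
  by apply: comb => t /fM; rewrite ler_norml => /andP[_]; lra.
have lo : 0 <= M / 2 * A j (monom 2) + ((- m - M * b) * b +
    (M / 2 * b ^+ 2 - f b + m * b + 1 * A j f)).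
  by apply: comb => t /fM; rewrite ler_norml => /andP[+ _]; lra.
by rewrite ler_norml /VarA -/b; apply/andP; split; lra.
Qed.

End RelativeDerivative.

Theorem mainTheorem1 (R : realType) (I : set R) (H : set (R -> R))
    (p : nat -> R -> R) (A : nat -> (R -> R) -> R) (f : R -> R)
  (I_itv : is_interval I)
  (H_sub : subspaceC I H)
  (H_e0 : H (monom 0)) (H_e1 : H (monom 1)) (H_e2 : H (monom 2))
  (p_cont : forall j, contI I (p j))
  (p_ge0 : forall j x, I x -> 0 <= p j x)
  (p_sum1 : forall x, I x -> series (fun j => p j x) @ \oo --> monom 0 x)
  (A_lin : forall j, linear_functional H (A j))
  (A_pos : forall j, positive_functional I H (A j))
  (A_e0 : forall j, A j (monom 0) = 1)
  (L_cvg : forall g, H g -> forall x, I x -> cvgn (psums p (fun j => A j g) x))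
  (L_C : maps_to_C I H (opL p A))
  (L_lin : linear_operator I H (opL p A))
  (L_pos : positive_operator I H (opL p A))
  (b_in : forall j, I (bary A j))
  (D_cvg : forall g, H g ->
     forall x, I x -> cvgn (psums p (fun j => g (bary A j)) x))
  (D_C : maps_to_C I H (opD p A))
  (f_H : H f) (f_C2 : C2 I f)
  (f2_bnd : has_ubound (absval_set I (derivI I (derivI I f)))) :
  forall x, I x ->
    `|opL p A f x - opD p A f x|
      <= 2^-1 * supnorm I (derivI I (derivI I f)) * opE p A x.
Proof.
set f' := derivI I f in f2_bnd *; set f'' := derivI I f' in f2_bnd *.
set M := supnorm I f'' => x Ix.
have [f_d f'_d _] := f_C2; rewrite -/f' in f'_d.
(* [f2_bnd] ensures that [M] is a genuine supremum and not the default value of [sup] on unbounded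
   sets. *)
have f''M t : I t -> `|f'' t| <= M.
  by move=> It; apply: ub_le_sup => //; exists t.
have AfM j : `|A j f - f (bary A j)| <= M / 2 * VarA A j.
  apply: (norm_functional_sub_bary_le (I := I) (H := H) (m := f' (bary A j))) => //.
  (* [cvg] means convergence to [lim], and this [lim] is [derivI]; hence [f_d] and [f'_d] are
     already [has_derivI] statements. *)
  by move=> t It; exact: (taylor1_rel I_itv f_d f'_d f''M).
have L_f := L_cvg f f_H x Ix.
have D_f := D_cvg f f_H x Ix.
(* Since [bary A j ^+ 2] is [monom 2] at [bary A j], the series of [E(L)] is that of [L] minus that
   of [D], both at [monom 2]. *)
have E_cvg : cvgn (psums p (VarA A) x).
  have -> : psums p (VarA A) x = psums p (fun j => A j (monom 2)) x
      - psums p (fun j => monom 2 (bary A j)) x.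
    apply/funext => n; rewrite /psums /series /GRing.add /GRing.opp /=.
    rewrite -sumrB; apply: eq_bigr => i _; rewrite -mulrBl.
    by rewrite /VarA /monom.
  by apply: is_cvgB; [exact: L_cvg|exact: D_cvg].
(* The inequality holds for every partial sum, by the triangle inequality and [AfM] termwise, and
   passes to the limit. *)
apply: (ler_cvg_to (cvg_norm (cvgB L_f D_f)) (cvgMl_tmp (a := 2^-1 * M) E_cvg)).
apply: nearW => n; rewrite /psums /series /GRing.add /GRing.opp /=.
rewrite -sumrB mulr_sumr; apply: (le_trans (ler_norm_sum _ _ _)).
apply: ler_sum => j _; rewrite -mulrBl normrM mulrA (ger0_norm (p_ge0 j x Ix)).
by rewrite ler_wpM2r ?p_ge0// [2^-1 * M]mulrC.
Qed.
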